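(* Let $D$ be a strongly connected balanced bipartite digraph of order $2a\geq 8$. Suppose that $\max\{d(x),d(y)\}\geq 2a-1$ for every pair of distinct vertices $x,y$ with a common out-neighbour. If $D$ is not isomorphic to the digraph $D(8)$, then $D$ is hamiltonian.
   Context: Digraphs are finite, without loops and without multiple arcs (a pair of opposite arcs $x\to y$, $y\to x$, called a 2-cycle $x\leftrightarrow y$, is allowed). For a vertex $x$, $d(x)=d^+(x)+d^-(x)$ is the sum of its out-degree and in-degree. A bipartite digraph with partite sets $X,Y$ is balanced if $|X|=|Y|$. A digraph is hamiltonian if it has a directed cycle through all its vertices. $D(8)$ is the bipartite digraph with partite sets $X=\{x_0,x_1,x_2,x_3\}$, $Y=\{y_0,y_1,y_2,y_3\}$ whose arc set consists exactly of the arcs $y_0x_1$, $y_1x_0$, $x_2y_3$, $x_3y_2$ together with both arcs of each of the 2-cycles $x_i\leftrightarrow y_i$ ($i=0,1,2,3$), $y_0\leftrightarrow x_2$, $y_0\leftrightarrow x_3$, $y_1\leftrightarrow x_2$, $y_1\leftrightarrow x_3$. *)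

(* Defs.v *)
From mathcomp Require Import all_boot.

Set Implicit Arguments.
Unset Strict Implicit.
Unset Printing Implicit Defensive.

(* A finite digraph without multiple arcs is a relation e on a finType, where
   e x y means x -> y; being loopless is the property [irreflexive e]. *)

Section Digraph.

Variables (T : finType) (e : rel T).

Definition outdeg (x : T) : nat := #|[set y | e x y]|.
Definition indeg (x : T) : nat := #|[set y | e y x]|.
Definition deg (x : T) : nat := outdeg x + indeg x.

Definition strongly_connected : Prop := forall x y : T, connect e x y.

Definition partite_sets (X Y : {set T}) : Prop :=
  [/\ X :|: Y = [set: T], X :&: Y = set0
    & forall x y, e x y -> (x \in X /\ y \in Y) \/ (x \in Y /\ y \in X)].

Definition balanced_bipartite : Prop :=
  exists X Y : {set T}, partite_sets X Y /\ #|X| = #|Y|.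

Definition common_out_neighbour (x y : T) : Prop :=
  exists z : T, e x z /\ e y z.

(* [ucycle] also holds of the empty sequence, hence the condition on c. *)
Definition hamiltonian : Prop :=
  exists c : seq T, [/\ c != [::], ucycle e c & forall x : T, x \in c].

End Digraph.

Definition digraph_iso (T U : finType) (e : rel T) (r : rel U) : Prop :=
  exists f : T -> U, bijective f /\ forall x y : T, r (f x) (f y) = e x y.

(* [inl i] is the vertex x_i and [inr i] is the vertex y_i. *)
Definition D8_vertex : finType := ('I_4 + 'I_4)%type.

(* Both arcs of the 2-cycles x_i <-> y_j are given by [D8_two_cycle i j]. *)
Definition D8_two_cycle (i j : nat) : bool :=
  (i == j) || ((i, j) \in [:: (2, 0); (3, 0); (2, 1); (3, 1)]).

Definition D8 : rel D8_vertex := fun u v =>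
  match u, v with
  | inl i, inr j =>
      D8_two_cycle i j || ((nat_of_ord i, nat_of_ord j) \in [:: (2, 3); (3, 2)])
  | inr j, inl i =>
      D8_two_cycle i j || ((nat_of_ord j, nat_of_ord i) \in [:: (0, 1); (1, 0)])
  | _, _ => false
  end.

(* Main.v *)
(** Call a vertex big if its degree is at least [2a - 1]: it then misses at most
    one arc of the complete bipartite digraph.  By the degree condition every
    vertex has at most one small in-neighbour, so unless all vertices are small
    (and the digraph is a single cycle) each side has at most two small vertices.
    Take a cycle factor [f] with the fewest cycles.  If [u] and [v] lie on
    different cycles, then [u -> f v] and [v -> f u] are not both arcs, since
    exchanging them would merge the two cycles.
    - If a side has two small vertices, each big vertex of the other side misses
      exactly one arc, coming from one of them.  These big vertices then lie on
      one cycle [L], and nothing leaves the complement of [L] unless the digraph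
      is D(8).
    - If each side has at most one small vertex, counting the arcs missing
      between a cycle and its complement shows that some cycle is a 2-cycle on
      the two small vertices, which leads to two big vertices on different
      cycles violating the exchange property. *)

Require Import Defs.
From mathcomp Require Import all_boot all_fingroup.
From mathcomp Require Import zify.

Set Implicit Arguments.
Unset Strict Implicit.
Unset Printing Implicit Defensive.

(** * Closed sets, orbits and cycle factors as permutations *)

Lemma closed_set_full (T : finType) (e : rel T) (A : {set T}) (x : T) :
  strongly_connected e -> x \in A ->
  (forall u v, u \in A -> e u v -> v \in A) -> forall y, y \in A.
Proof.
move=> strong xA clA y; have /connectP[p] := strong x y.
elim: p x xA => [|z p IHp] x xA /= => [_ ->|/andP[exz pzp] yz] //.
exact: IHp (clA _ _ xA exz) pzp yz.
Qed.

Lemma porbit_closed (T : finType) (f : {perm T}) (A : {set T}) (x : T) :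
  x \in A -> (forall u, u \in A -> f u \in A) ->
  forall y, y \in porbit f x -> y \in A.
Proof.
move=> xA clA y /porbitP[n ->]; elim: n => [|n IHn]; first by rewrite expg0 perm1.
by rewrite expgSr permM clA.
Qed.

Lemma mem_porbit_perm (T : finType) (f : {perm T}) (x y : T) :
  (f y \in porbit f x) = (y \in porbit f x).
Proof. by have := porbit_perm f 1 y; rewrite expg1 porbit_sym => ->; rewrite porbit_sym. Qed.

Lemma hamiltonian_perm (T : finType) (e : rel T) (f : {perm T}) (x : T) :
  (forall v, e v (f v)) -> (forall v, v \in porbit f x) -> hamiltonian e.
Proof.
move=> ef fx; exists (fingraph.orbit f x); split.
- by have := in_orbit f x; case: (fingraph.orbit f x).
- rewrite /ucycle orbit_uniq andbT.
  apply: sub_cycle (cycle_orbit (@perm_inj _ f) x) => u v /eqP<-; exact: ef.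
- move=> y; rewrite -fconnect_orbit; have /porbitP[n ->] := fx y.
  by rewrite permX fconnect_iter.
Qed.

Lemma swap_perm_exists (T : finType) (c : T -> bool) :
  #|[set v | c v]| = #|[set v | ~~ c v]| ->
  exists f : {perm T}, forall v, c (f v) = ~~ c v.
Proof.
pose A b := [set v | c v == b].
move=> eqA; have cardA b : #|A b| = #|A (~~ b)|.
  have AT : A true = [set v | c v] by apply/setP=> v; rewrite !inE eqb_id.
  have AF : A false = [set v | ~~ c v] by apply/setP=> v; rewrite !inE eqbF_neg.
  by case: b; rewrite /= AT AF.
(* Pairing equal positions in the two enumerations makes [g] an involution; the default [v] is never
   reached, by [ltg]. *)
pose g v := nth v (enum (A (~~ c v))) (index v (enum (A (c v)))).
have ltg v : index v (enum (A (c v))) < size (enum (A (~~ c v))).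
  by rewrite -cardE -cardA cardE index_mem mem_enum inE.
have cg v : c (g v) = ~~ c v.
  by have := mem_nth v (ltg v); rewrite mem_enum inE => /eqP.
have gK : involutive g.
  move=> v; rewrite {1}/g cg negbK {2}/g index_uniq ?enum_uniq //.
  by rewrite nth_index // mem_enum inE.
by exists (perm (inv_inj gK)) => v; rewrite permE.
Qed.

(** The arithmetic behind [cut_not_mixed]. If [k <= l], the bounds give 2kl <= 2k + l, which forces
    k = 1 and l <= 2. *)
Lemma no_mixed_cut k l m n : 0 < k -> 0 < l -> 4 <= k + l ->
  2 * (k * l) <= m + n -> m <= k + l -> n <= k -> n <= l -> False.
Proof. nia. Qed.

(** * Big and small vertices *)

Section DegreeCondition.

Variables (T : finType) (e : rel T) (c : T -> bool) (a : nat).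
Hypothesis bip : forall u v, e u v -> c v = ~~ c u.
Hypothesis card_side : forall b, #|[set v | c v == b]| = a.
Hypothesis a_ge4 : 4 <= a.
Hypothesis strong : strongly_connected e.
Hypothesis deg_cond : forall x y : T, x <> y -> common_out_neighbour e x y ->
  2 * a - 1 <= maxn (deg e x) (deg e y).

Definition small v := deg e v < 2 * a - 1.
Definition miss_arcs u v : nat := ~~ e u v + ~~ e v u.
(** The sides are the fibres of the colouring [c]; a side and its opposite are [b] and [~~ b], so
    each lemma serves both. *)
Definition small_side b : {set T} := [set v | c v == b & small v].
Definition big_side b : {set T} := [set v | c v == b & ~~ small v].

Lemma small_in_uniq u v z : small u -> small v -> e u z -> e v z -> u = v.
Proof.
move=> su sv euz evz; apply/eqP/idPn => /eqP uv.
have := deg_cond uv; rewrite /small in su sv => /(_ (ex_intro _ z (conj euz evz))).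
by rewrite leq_max; lia.
Qed.

Lemma outdeg_sum v : outdeg e v = \sum_(w | c w == ~~ c v) e v w.
Proof.
rewrite /outdeg -sum1_card [LHS]big_mkcond [RHS]big_mkcond.
apply: eq_bigr => w _; rewrite inE.
by have := @bip v w; case: (e v w) => [/(_ isT)->|_]; rewrite ?eqxx ?if_same.
Qed.

Lemma indeg_sum v : indeg e v = \sum_(w | c w == ~~ c v) e w v.
Proof.
rewrite /indeg -sum1_card [LHS]big_mkcond [RHS]big_mkcond.
apply: eq_bigr => w _; rewrite inE.
by have := @bip w v; case: (e w v) => [/(_ isT)->|_]; rewrite ?negbK ?eqxx ?if_same.
Qed.

Lemma deg_miss v : deg e v + \sum_(w | c w == ~~ c v) miss_arcs v w = 2 * a.
Proof.
rewrite /deg outdeg_sum indeg_sum -!big_split /=.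
rewrite (eq_bigr (fun=> 2)); last first.
  by move=> w _; rewrite /miss_arcs; case: (e v w) (e w v) => [] [].
by rewrite sum_nat_const -(card_side (~~ c v)) mulnC; congr (_ * _); apply: eq_card => w; rewrite !inE.
Qed.

Lemma big_missP v : ~~ small v = (\sum_(w | c w == ~~ c v) miss_arcs v w <= 1).
Proof. by rewrite /small; have := deg_miss v; lia. Qed.

Lemma big_miss_sum v (A : {set T}) : ~~ small v ->
  (forall w, w \in A -> c w = ~~ c v) -> \sum_(w in A) miss_arcs v w <= 1.
Proof.
rewrite big_missP => + cA; apply: leq_trans.
rewrite big_mkcond [X in _ <= X]big_mkcond; apply: leq_sum => w _.
by case: ifP => // /cA->; rewrite eqxx.
Qed.

Lemma big_miss1 v w1 w2 : ~~ small v -> c w1 = ~~ c v -> c w2 = ~~ c v ->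
  w1 != w2 -> miss_arcs v w1 + miss_arcs v w2 <= 1.
Proof.
move=> bv c1 c2 w12; have := @big_miss_sum v [set w1; w2] bv.
rewrite big_setU1 ?inE // big_set1; apply.
by move=> w /set2P[]->.
Qed.

Lemma big_or v w : ~~ small v -> c w = ~~ c v -> e v w || e w v.
Proof.
move=> bv cw; have: miss_arcs v w <= 1.
  by have := @big_miss_sum v [set w] bv; rewrite big_set1; apply=> x /set1P->.
by rewrite /miss_arcs; case: (e v w) (e w v) => [] [].
Qed.

(** An arc missing at [w] uses up the only one that a big vertex can miss. *)
Lemma big_full v w w' : ~~ small v -> c w = ~~ c v -> c w' = ~~ c v -> w != w' ->
  ~~ (e v w && e w v) -> e v w' /\ e w' v.
Proof.
move=> bv cw cw' ww'; have := big_miss1 bv cw cw' ww'; rewrite /miss_arcs.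
by case: (e v w) (e w v) (e v w') (e w' v) => [] [] [] [].
Qed.

Lemma in_neighbour v : exists u, e u v.
Proof.
apply/existsP; apply: contraT; rewrite negb_exists => /forallP ev.
have: v \notin ~: [set v] by rewrite !inE eqxx.
have /card_gt0P[u]: 0 < #|[set w | c w == ~~ c v]| by rewrite card_side; lia.
rewrite inE => /eqP cu; case/negP.
apply: (@closed_set_full _ e _ u) => //; first by rewrite !inE; apply/eqP=> uv; move: cu; rewrite uv; case: (c v).
by move=> x y _; rewrite !inE; apply: contraTneq => ->; exact: ev.
Qed.

Lemma out_neighbour v : exists u, e v u.
Proof.
apply/existsP; apply: contraT; rewrite negb_exists => /forallP ev.
have /card_gt0P[u]: 0 < #|[set w | c w == ~~ c v]| by rewrite card_side; lia.
rewrite inE => /eqP cu.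
have: u \in [set v].
  apply: (@closed_set_full _ e _ v) => //; first by rewrite inE.
  by move=> x y /set1P->; rewrite (negPf (ev y)).
by move/set1P=> uv; move: cu; rewrite uv; case: (c v).
Qed.

(** Of three small vertices at most one sends an arc to [z], so [z] would miss two arcs. *)
Lemma small_side_le2 b z : z \in big_side (~~ b) -> #|small_side b| <= 2.
Proof.
rewrite inE => /andP[/eqP cz bz]; rewrite leqNgt; apply/negP.
case/card_gt2P=> x1 [x2] [x3] []; rewrite !inE.
case=> /andP[/eqP c1 s1] /andP[/eqP c2 s2] /andP[/eqP c3 s3] [n12 n23 n31].
have n13 : x1 != x3 by rewrite eq_sym.
have cn : b = ~~ c z by rewrite cz negbK.
rewrite cn in c1 c2 c3.
have nand x y : small x -> small y -> x != y -> ~~ (e x z && e y z).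
  by move=> sx sy; apply: contraNN => /andP[ex ey]; apply/eqP/(small_in_uniq sx sy ex).
have := nand _ _ s1 s2 n12; have := nand _ _ s2 s3 n23; have := nand _ _ s1 s3 n13.
have := big_full bz c1 c2 n12; have := big_full bz c2 c3 n23.
have := big_full bz c1 c3 n13.
case: (e x1 z) (e x2 z) (e x3 z) => [] [] [] //; rewrite ?andbF /=.
- by move=> _ /(_ isT)[].
- by move=> /(_ isT)[].
- by move=> _ _ /(_ isT)[].
- by move=> /(_ isT)[].
Qed.

Lemma card_big_side b : #|small_side b| + #|big_side b| = a.
Proof.
rewrite -(card_side b) -[RHS](cardsID [set v | small v]).
congr (_ + _); apply: eq_card => v; rewrite !inE //.
by rewrite andbC.
Qed.

(** A big vertex leaves at most two small ones on the opposite side, which thus has a big vertex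
    too, since [a >= 4]; that one bounds the first side. *)
Lemma all_small_or_few :
  (forall v, small v) \/ (forall b, #|small_side b| <= 2).
Proof.
case: (pickP (fun z => ~~ small z)) => [z bz|sm]; last first.
  by left=> v; move/negbFE: (sm v).
right; have zb : z \in big_side (~~ ~~ c z) by rewrite negbK inE eqxx.
have le2 := small_side_le2 zb; have := card_big_side (~~ c z) => cz.
have /card_gt0P[w wb]: 0 < #|big_side (~~ c z)| by lia.
have le2' := small_side_le2 wb.
move=> b; case: (b =P c z) => [->//|/eqP bz'].
by have ->: b = ~~ c z by case: b (c z) bz' => [] [].
Qed.

(** * Minimal cycle factors *)

(* Among the permutations exchanging the two sides, one with the largest number
   of arcs [v -> f v] consists of arcs only: otherwise an exchange of two or
   three values of [f] on the same side gains an arc. *)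
Lemma cycle_factor_exists : exists f : {perm T}, forall v, e v (f v).
Proof.
have [f0 cf0] : exists f : {perm T}, forall v, c (f v) = ~~ c v.
  apply: swap_perm_exists; transitivity a.
    by rewrite -(card_side true); apply: eq_card => v; rewrite !inE eqb_id.
  by rewrite -(card_side false); apply: eq_card => v; rewrite !inE eqbF_neg.
pose P (f : {perm T}) := [forall v, c (f v) == ~~ c v].
have Pf0 : P f0 by apply/forallP=> v; rewrite cf0.
case: (@arg_maxnP _ f0 P (fun f : {perm T} => #|[set v | e v (f v)]|) Pf0).
move=> f /forallP/= Pf fmax; exists f.
have cf v : c (f v) = ~~ c v by apply/eqP.
move=> u; apply: contraT => bad_u.
have improve (s : {perm T}) : (forall w, c (s w) = c w) ->
    (forall w, e w (f w) -> e w (f (s w))) -> e u (f (s u)) -> False.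
  move=> cs efs eus; have := fmax (s * f)%g.
  suff /proper_card: [set v | e v (f v)] \proper [set v | e v ((s * f)%g v)].
    rewrite ltnNge => /negP lt_fs /(_ _) le_fs; apply/lt_fs/le_fs.
    by apply/forallP=> w; rewrite permM cf cs.
  apply/properP; split; last by exists u; rewrite inE ?permM.
  by apply/subsetP=> w; rewrite !inE permM; apply: efs.
have exch2 v : c v = c u -> e u (f v) -> (e v (f v) -> e v (f u)) -> False.
  move=> cv euv evu; apply: (improve (tperm u v)); rewrite ?tpermL //.
  - by move=> w; case: tpermP => [->|->|].
  - by move=> w; case: tpermP => [->|->|]; rewrite ?(negPf bad_u).
have exch3 v w : c v = c u -> c w = c u -> v != u -> w != u -> v != w ->
    e u (f v) -> e v (f w) -> e w (f u) -> False.
  move=> cv cw vu wu vw euv evw ewu.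
  apply: (improve (tperm u v * tperm u w)%g); rewrite ?permM ?tpermL.
  - move=> x; rewrite permM; case: (tpermP u v x) => [->|->|/eqP xu /eqP xv].
    + by rewrite tpermD // eq_sym.
    + by rewrite tpermL cw.
    + by case: tpermP => [->|->|].
  - move=> x; rewrite permM; case: (tpermP u v x) => [->|->|/eqP xu /eqP xv].
    + by rewrite (negPf bad_u).
    + by rewrite tpermL.
    + by case: tpermP => [->|->|]; rewrite ?(negPf bad_u).
  - by rewrite tpermD // eq_sym.
have [y ey] := in_neighbour (f u).
have cy : c y = c u by have := bip ey; rewrite cf => /negb_inj.
have [y' ey'] := out_neighbour u; pose v := (f^-1)%g y'.
have ev : e u (f v) by rewrite permKV.
have cv : c v = c u by have := bip ev; rewrite cf => /negb_inj.
have yu : y != u by apply: contraNneq bad_u => {1}<-.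
have vu : v != u by apply: contraNneq bad_u => {2}<-.
have fyu : f u != f y by rewrite (inj_eq perm_inj) eq_sym.
(* If [u] is big, its only missing arc is the one to [f u], so [u -> f y] and exchanging [u] and [y]
   gains an arc. Otherwise [v] turns out to be big and to miss its arc to [f u], so [v -> f y], and
   the rotation of [u], [v], [y] gains an arc. *)
have [bu|su] := boolP (small u); last first.
  case: (@exch2 y) => //.
  by case: (big_full su _ _ fyu); rewrite ?cf ?cy ?(negPf bad_u).
have evv : e v (f v).
  by apply: contraT => H; case: (exch2 v) => //; rewrite (negPf H).
have nevu : ~~ e v (f u) by apply/negP=> H; exact: (exch2 v).
have bv : ~~ small v.
  by apply: contraNN vu => sv; rewrite (small_in_uniq bu sv ev evv).
have vy : v != y by apply: contraNneq nevu => ->.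
case: (@exch3 v y) => //.
by case: (big_full bv _ _ fyu); rewrite ?cf ?cy ?cv ?(negPf nevu).
Qed.

Lemma minimal_cycle_factor : exists f : {perm T}, (forall v, e v (f v)) /\
  forall u v, v \notin porbit f u -> ~~ (e u (f v) && e v (f u)).
Proof.
have [f0 ef0] := cycle_factor_exists.
pose P (f : {perm T}) := [forall v, e v (f v)].
have Pf0 : P f0 by apply/forallP.
case: (@arg_minnP _ f0 P (fun f : {perm T} => #|porbits f|) Pf0).
move=> f /forallP/= ef fmin; exists f; split=> // u v uv; apply/negP=> /andP[euv evu].
have /fmin : P (tperm u v * f)%g.
  by apply/forallP=> w; rewrite permM; case: tpermP => [->|->|].
have := porbits_mul_tperm f u v; rewrite /= porbit_sym uv.
by case: (u != v) => /=; lia.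
Qed.

(** One of [x1], [x2] sends no arc to [z], since [z] has at most one small in-neighbour; this is the
    only arc missing at [z]. *)
Lemma big_dominates b x1 x2 z : x1 \in small_side b -> x2 \in small_side b ->
    x1 != x2 -> z \in big_side (~~ b) ->
  (forall x, c x = b -> e z x) /\ (forall v, v \in big_side b -> e v z).
Proof.
rewrite !inE => /andP[/eqP c1 s1] /andP[/eqP c2 s2] n12 /andP[/eqP cz bz].
have cb x : c x = b -> c x = ~~ c z by rewrite cz negbK.
have [x [cx sx nx]] : exists x, [/\ c x = b, small x & ~~ e x z].
  have [e1|] := boolP (e x1 z); last by exists x1.
  exists x2; split=> //; apply: contraNN n12 => e2.
  by rewrite (small_in_uniq s1 s2 e1 e2).
have full v : c v = b -> v != x -> e z v /\ e v z.
  by move=> cv vx; apply: (big_full bz (cb _ cx) (cb _ cv)); rewrite ?(negPf nx) ?andbF // eq_sym.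
split=> [v cv|v]; last first.
  rewrite inE => /andP[/eqP cv bv]; have [] // := full v cv.
  by apply: contraNneq bv => ->.
have [->|vx] := eqVneq v x; last by have [] := full v cv vx.
by have := big_or bz (cb _ cx); rewrite (negPf nx) orbF.
Qed.

Section MinimalFactor.

Variables (f : {perm T}) (u0 v0 : T).
Hypothesis ef : forall v, e v (f v).
Hypothesis star : forall u v, v \notin porbit f u -> ~~ (e u (f v) && e v (f u)).
Hypothesis two_orbits : v0 \notin porbit f u0.

Let cf v : c (f v) = ~~ c v. Proof. exact: bip. Qed.

Let star_orbit x u v : u \in porbit f x -> v \notin porbit f x ->
  e u (f v) -> e v (f u) -> False.
Proof.
move=> ux vx euv evu; have /star : v \notin porbit f u.
  by apply: contraNN vx; move: ux; rewrite -eq_porbit_mem => /eqP->.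
by rewrite euv evu.
Qed.

(** Every vertex would have its [f]-preimage as only in-neighbour, so the orbit of [u0] would be
    closed under all arcs. *)
Lemma not_all_small : (forall v, small v) -> False.
Proof.
move=> sm; case/negP: two_orbits.
apply: (closed_set_full strong (porbit_id f u0)) => u v uA euv.
suff ->: v = f u by rewrite mem_porbit_perm.
have := ef ((f^-1)%g v); rewrite permKV => /(small_in_uniq (sm _) (sm _) euv)->.
by rewrite permKV.
Qed.

(** By [big_dominates] both [z -> f w] and [w -> f z] are arcs, which the exchange property forbids
    on different cycles. *)
Lemma big_one_orbit b z w : 1 < #|small_side b| ->
  z \in big_side (~~ b) -> w \in big_side (~~ b) -> w \in porbit f z.
Proof.
case/card_gt1P=> x1 [x2] [S1 S2 n12] zb wb; apply: contraT => /star.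
have [ez _] := big_dominates S1 S2 n12 zb; have [ew _] := big_dominates S1 S2 n12 wb.
move: zb wb; rewrite !inE => /andP[/eqP cz _] /andP[/eqP cw _].
by rewrite ez ?ew // cf ?cw ?cz negbK.
Qed.

(** * A side with two small vertices *)

Section TwoSmall.

Variable b : bool.
Hypothesis few : forall b : bool, #|small_side b| <= 2.
Hypothesis two : 1 < #|small_side b|.
Variable z0 : T.
Hypothesis z0b : z0 \in big_side (~~ b).
Let L := porbit f z0.

Let outL_small w : c w = ~~ b -> w \notin L -> small w.
Proof.
move=> cw; apply: contraNT => bw; apply: big_one_orbit two z0b _.
by rewrite inE cw eqxx.
Qed.

(** Write [u = f v]. A small [v] would be a second small in-neighbour of [u]; a big [v] dominates
    side [b], so [v -> f w] completes a forbidden exchange. *)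
Let outL_exit w u : c w = ~~ b -> w \notin L -> e w u -> u \notin L.
Proof.
move=> cw wL ewu; apply/negP=> uL; pose v := (f^-1)%g u.
have uE : u = f v by rewrite permKV.
have vL : v \in L by rewrite -mem_porbit_perm -uE.
have cv : c v = ~~ b by have := bip ewu; rewrite uE cf => /negb_inj->.
rewrite uE in ewu; have [sv|bv] := boolP (small v).
  by move: (wL); rewrite (small_in_uniq (outL_small cw wL) sv ewu (ef v)) vL.
have vb : v \in big_side (~~ b) by rewrite inE cv eqxx.
have /card_gt1P[x1 [x2] [S1 S2 n12]] := two.
have [ev _] := big_dominates S1 S2 n12 vb.
by apply: (star_orbit vL wL) => //; apply: ev; rewrite cf cw negbK.
Qed.

Let big_enters v w : v \in big_side b -> v \in L -> c w = b -> w \notin L -> e v (f w).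
Proof.
rewrite inE => /andP[/eqP cv bv] vL cw wL.
have := big_or bv; rewrite cv => /(_ (f w)); rewrite cf cw => /(_ erefl)/orP[//|].
by move/outL_exit; rewrite cf cw mem_porbit_perm wL vL => /(_ erefl isT).
Qed.

(** Otherwise the complement of [L] is closed: an arc [w -> f v] into [L] from side [b] has [w]
    small, so [v] is big, and [big_enters] gives the forbidden [v -> f w]. *)
Lemma big_outside : exists2 w, w \in big_side b & w \notin L.
Proof.
have [w /andP[]|noB] := pickP (fun w => (w \in big_side b) && (w \notin L)).
  by exists w.
have z0L : z0 \in L by apply: porbit_id.
have [w wL] : exists w, w \notin L.
  have [uL|] := boolP (u0 \in L); last by exists u0.
  by exists v0; move: uL; rewrite -eq_porbit_mem /L => /eqP<-.
suff: z0 \in ~: L by rewrite inE z0L.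
apply: (closed_set_full strong (x := w)); first by rewrite inE.
move=> {wL}w u; rewrite !inE => wL ewu; have [cw|cw] := eqVneq (c w) b; last first.
  by apply: outL_exit ewu => //; case: (c w) b cw => [] [].
apply/negP=> uL; pose v := (f^-1)%g u.
have uE : u = f v by rewrite permKV.
have vL : v \in L by rewrite -mem_porbit_perm -uE.
have cv : c v = b by have := bip ewu; rewrite uE cf cw => /negb_inj->.
rewrite uE in ewu; have sw : small w.
  by have := noB w; rewrite inE cw eqxx wL andbT => /negbFE.
have [sv|bv] := boolP (small v).
  by case/negP: wL; rewrite (small_in_uniq sw sv ewu (ef v)).
have vb : v \in big_side b by rewrite inE cv eqxx.
exact: (star_orbit vL wL (big_enters vb vL cw wL)).
Qed.

(** Take big [w] outside [L] and another big [w'] on side [b]; their images are the two small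
    vertices. Were [f w'] big with [w'] in [L], then [w -> f w'] and [w' -> f w] would be a
    forbidden exchange. *)
Lemma other_side_two_small : 1 < #|small_side (~~ b)|.
Proof.
have [w wb wL] := big_outside; have /andP[/eqP cw bw] : (c w == b) && ~~ small w.
  by rewrite inE in wb.
have [w' w'b ww'] : exists2 w', w' \in big_side b & w != w'.
  have /card_gt1P[x [y [xb yb xy]]] : 1 < #|big_side b|.
    by have := card_big_side b; have := few b; lia.
  by have [wx|] := eqVneq w x; [exists y; rewrite // wx | exists x].
have /andP[/eqP cw' bw'] : (c w' == b) && ~~ small w' by rewrite inE in w'b.
apply/card_gt1P; exists (f w), (f w').
have sfw : small (f w) by apply: outL_small; rewrite ?cf ?cw ?mem_porbit_perm.
split; rewrite ?(inj_eq perm_inj) // inE cf ?cw ?cw' eqxx //=.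
have [w'L|] := boolP (w' \in L); last first.
  by move=> w'L; apply: outL_small; rewrite ?cf ?cw' ?mem_porbit_perm.
apply: contraT => bfw'; have /card_gt1P[x1 [x2] [S1 S2 n12]] := two.
have fw'b : f w' \in big_side (~~ b) by rewrite inE cf cw' eqxx.
have [_ /(_ w wb) eww'] := big_dominates S1 S2 n12 fw'b.
by case: (star_orbit w'L wL (big_enters w'b w'L cw wL) eww').
Qed.

(* [f] maps big vertices to small ones, so by counting it swaps the two kinds. *)
Lemma in_orbit_side v : (v \in L) = (small v == (c v == b)).
Proof.
have [w wb wL] := big_outside.
have bigb x : x \in big_side b -> x \notin L.
  move=> xb; have := @big_one_orbit (~~ b) w x other_side_two_small.
  rewrite negbK => /(_ wb xb); rewrite -eq_porbit_mem => /eqP xw.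
  by rewrite porbit_sym xw porbit_sym.
have bign x : x \in big_side (~~ b) -> x \in L by exact: big_one_orbit.
have fbig x : ~~ small x -> small (f x).
  move=> bx; have [cx|cx] := eqVneq (c x) b.
    have xb : x \in big_side b by rewrite inE cx eqxx.
    by apply: outL_small; rewrite ?cf ?cx ?mem_porbit_perm ?bigb.
  have {}cx : c x = ~~ b by case: (c x) b cx => [] [].
  have /bign xL : x \in big_side (~~ b) by rewrite inE cx eqxx.
  apply: contraTT xL => bfx; rewrite -mem_porbit_perm bigb //.
  by rewrite inE cf cx negbK eqxx.
(* As [a >= 4], at least two big vertices inject into at most two small ones, so the injection is
   onto. *)
have fsurj b' y : y \in small_side b' -> exists2 x, x \in big_side (~~ b') & y = f x.
  have sub : f @: big_side (~~ b') \subset small_side b'.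
    apply/subsetP=> _ /imsetP[x + ->]; rewrite !inE => /andP[/eqP cx /fbig->].
    by rewrite cf cx negbK eqxx.
  have := subset_leqif_cards sub; case=> _.
  rewrite card_imset; last exact: perm_inj.
  have leS := few b'; have := card_big_side (~~ b'); have := few (~~ b').
  have := subset_leq_card sub; rewrite card_imset; last exact: perm_inj.
  move=> h1 h2 h3 /esym; have -> : #|big_side (~~ b')| == #|small_side b'| by lia.
  by move/eqP<- => /imsetP[x xb ->]; exists x.
have [sv|bv] := boolP (small v); have [cv|cv] := eqVneq (c v) b; rewrite /=.
- have /fsurj[x xb ->] : v \in small_side b by rewrite inE cv eqxx.
  by rewrite mem_porbit_perm bign.
- have {}cv : c v = ~~ b by case: (c v) b cv => [] [].
  have /fsurj[x] : v \in small_side (~~ b) by rewrite inE cv eqxx.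
  by rewrite negbK => xb ->; rewrite mem_porbit_perm; apply/negbTE/bigb.
- by apply/negbTE/bigb; rewrite inE cv eqxx.
- by apply: bign; rewrite inE bv andbT; case: (c v) b cv => [] [].
Qed.

Let small_perm v : small (f v) = ~~ small v.
Proof.
have := in_orbit_side (f v); rewrite mem_porbit_perm in_orbit_side cf.
by case: (small v) (small (f v)) (c v) b => [] [] [] [].
Qed.

(** The big vertices of side [b] inject under [f] into at most two small ones, so each side has at
    most four vertices. *)
Let card_le8 : #|T| <= 8.
Proof.
have le2 : #|big_side b| <= 2.
  rewrite -(card_imset _ (@perm_inj _ f)); apply: leq_trans (few (~~ b)).
  apply/subset_leq_card/subsetP=> _ /imsetP[m + ->].
  by rewrite !inE cf small_perm => /andP[/eqP-> ->]; rewrite eqxx.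
have a4 : a <= 4 by rewrite -(card_big_side b) (leq_add (few b) le2).
rewrite -cardsT -(cardsID [set v | c v == b]) setTI card_side.
rewrite (leq_add a4) // (leq_trans _ a4) // -(card_side (~~ b)).
by apply/subset_leq_card/subsetP=> v; rewrite !inE andbT; case: (c v) (b) => [] [].
Qed.

(** All arcs are determined: big vertices dominate the opposite side, small ones on opposite sides
    are not adjacent, and a small [s] has [f s] as only out-neighbour. *)
Lemma two_small_D8 : digraph_iso e D8.
Proof.
have two' := other_side_two_small.
have /cards2P[x1 [x2 [n12 Sx]]] : #|small_side b| == 2 by rewrite eqn_leq few.
have /cards2P[y1 [y2 [n34 Sy]]] : #|small_side (~~ b)| == 2 by rewrite eqn_leq few.
have [X1 X2] : x1 \in small_side b /\ x2 \in small_side b.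
  by rewrite Sx !inE !eqxx orbT.
have [Y1 Y2] : y1 \in small_side (~~ b) /\ y2 \in small_side (~~ b).
  by rewrite Sy !inE !eqxx orbT.
have fS b' x : x \in small_side b' -> f x \in big_side (~~ b').
  by rewrite !inE cf small_perm => /andP[/eqP-> ->]; rewrite eqxx.
have [N1 N2 M1 M2] := And4 (fS _ _ X1) (fS _ _ X2) (fS _ _ Y1) (fS _ _ Y2).
rewrite negbK in M1 M2.
have cS b' x : x \in small_side b' -> (c x = b') * small x.
  by rewrite inE => /andP[/eqP].
have cB b' x : x \in big_side b' -> (c x = b') * (small x = false).
  by rewrite inE => /andP[/eqP-> /negbTE].
have domX n : n \in big_side (~~ b) -> _ := big_dominates X1 X2 n12.
have domY m y : m \in big_side b -> c y = ~~ b -> e m y.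
  move=> mb; apply: (big_dominates Y1 Y2 n34 _).1; by rewrite negbK.
(* An arc [y -> x] would enter [L] from outside. If [x -> y = f v], then [v] is a big vertex of side
   [b] outside [L], and [v -> f x] completes a forbidden exchange. *)
have small_small x y : x \in small_side b -> y \in small_side (~~ b) ->
    (e x y = false) * (e y x = false).
  move=> xS yS; have xL : x \in L by rewrite in_orbit_side !(cS _ _ xS) eqxx.
  have yL : y \notin L by rewrite in_orbit_side !(cS _ _ yS); case: (b).
  split; apply/negbTE/negP; last first.
    by move/(outL_exit (cS _ _ yS).1 yL); rewrite xL.
  move=> exy; pose v := (f^-1)%g y; have yE : y = f v by rewrite permKV.
  have vb : v \in big_side b.
    move: yS; rewrite !inE yE cf small_perm => /andP[/eqP/negb_inj-> ->].
    by rewrite eqxx.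
  apply: (@star_orbit z0 x v) => //; last 2 first.
  - by rewrite -yE.
  - exact: (domX _ (fS _ _ xS)).2.
  - by rewrite -mem_porbit_perm -yE.
have out2 s1 s2 : small s1 -> small s2 -> s1 != s2 -> e s1 (f s2) = false.
  move=> ss1 ss2; apply: contraNF => e12.
  by rewrite (small_in_uniq ss1 ss2 e12 (ef s2)).
(* The small vertices become x_0, x_1, y_2, y_3 of D(8), and their images under [f] become y_0, y_1,
   x_2, x_3. *)
pose hx := [:: x1; x2; f y1; f y2]; pose hy := [:: f x1; f x2; y1; y2].
have neqS b1 b2 s t : s \in small_side b1 -> t \in big_side b2 -> (s == t) = false.
  by move=> sS; apply: contraTF => /eqP<-; rewrite inE (cS _ _ sS).2 andbF.
have uniqx : uniq hx.
  by rewrite /= !inE !negb_or (inj_eq perm_inj) n12 n34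
    !(neqS b b) //.
have uniqy : uniq hy.
  rewrite /= !inE !negb_or (inj_eq perm_inj) n12 n34 ![f _ == _]eq_sym.
  by rewrite !(neqS (~~ b) (~~ b)).
pose h (u : D8_vertex) := match u with inl i => nth x1 hx i | inr j => nth x1 hy j end.
have chx i : i < 4 -> c (nth x1 hx i) = b.
  by move: i => [|[|[|[|]]]] //= _; rewrite ?(cS _ _ X1) ?(cS _ _ X2) ?(cB _ _ M1) ?(cB _ _ M2).
have chy i : i < 4 -> c (nth x1 hy i) = ~~ b.
  by move: i => [|[|[|[|]]]] //= _; rewrite ?(cS _ _ Y1) ?(cS _ _ Y2) ?(cB _ _ N1) ?(cB _ _ N2).
have h_inj : injective h.
  move=> [i|i] [j|j] /= hij.
  - by congr inl; apply/val_inj/eqP; rewrite /= -(nth_uniq x1 _ _ uniqx) ?hij.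
  - by have := chx i (ltn_ord i); rewrite hij chy //; case: (b).
  - by have := chx j (ltn_ord j); rewrite -hij chy //; case: (b).
  - by congr inr; apply/val_inj/eqP; rewrite /= -(nth_uniq x1 _ _ uniqy) ?hij.
have cardT : #|T| <= #|{: D8_vertex}| by rewrite card_sum !card_ord card_le8.
have eh u v : D8 u v = e (h u) (h v).
  have same s t : c s = c t -> e s t = false.
    by move=> st; apply/negP=> /bip; rewrite st; case: (c t).
  have XY := (small_small _ _ X1 Y1, small_small _ _ X1 Y2,
              small_small _ _ X2 Y1, small_small _ _ X2 Y2).
  have n21 : x2 != x1 by rewrite eq_sym.
  have n43 : y2 != y1 by rewrite eq_sym.
  have E1 := (out2 _ _ (cS _ _ X1).2 (cS _ _ X2).2 n12,
              out2 _ _ (cS _ _ X2).2 (cS _ _ X1).2 n21,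
              out2 _ _ (cS _ _ Y1).2 (cS _ _ Y2).2 n34,
              out2 _ _ (cS _ _ Y2).2 (cS _ _ Y1).2 n43).
  have DX n x : n \in big_side (~~ b) -> c x = b -> e n x by case/domX=> + _ => /[apply].
  case: u v => [i|i] [j|j].
  - by rewrite /= same // !chx.
  - have [iM|iS] := ltnP 1 i.
      rewrite /= domY ?chy //; last by case: i iM => [[|[|[|[|]]]]].
      by case: i j iM => [[|[|[|[|]]]] //= ?] [[|[|[|[|]]]] //= ?].
    by case: i j iS => [[|[|[|[|]]]] //= ?] [[|[|[|[|]]]] //= ?]; rewrite ?XY ?E1 ?ef.
  - have [iM|iS] := ltnP i 2.
      rewrite /= DX ?chx //; last by case: i iM => [[|[|[|[|]]]]].
      by case: i j iM => [[|[|[|[|]]]] //= ?] [[|[|[|[|]]]] //= ?].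
    by case: i j iS => [[|[|[|[|]]]] //= ?] [[|[|[|[|]]]] //= ?]; rewrite ?XY ?E1 ?ef.
  - by rewrite /= same // !chy.
have [g hK gK] := inj_card_bij h_inj cardT.
exists g; split; first by exists h.
by move=> x y; rewrite eh !gK.
Qed.

End TwoSmall.

(** * At most one small vertex on each side *)

Section OneSmall.

Hypothesis one : forall b : bool, #|small_side b| <= 1.

Let small_uniq u v : small u -> small v -> c u = c v -> u = v.
Proof.
by move=> su sv cuv; apply: (card_le1_eqP (one (c v))); rewrite inE ?cuv eqxx.
Qed.

Definition part (A : {set T}) b : {set T} := [set v in A | c v == b].
Definition cross (A B : {set T}) := \sum_(u in A) \sum_(w in B) miss_arcs u w.

Lemma crossC A B : cross A B = cross B A.
Proof.
rewrite /cross exchange_big /=; apply: eq_bigr => u _; apply: eq_bigr => v _.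
by rewrite /miss_arcs addnC.
Qed.

Lemma cross_big b A B : (forall u, u \in part A b -> ~~ small u) ->
  cross (part A b) (part B (~~ b)) <= #|part A b|.
Proof.
move=> bigA; rewrite -[X in _ <= X]muln1 -sum_nat_const; apply: leq_sum => u uA.
apply: big_miss_sum (bigA u uA) _ => w; rewrite inE => /andP[_ /eqP->].
by move: uA; rewrite inE => /andP[_ /eqP->].
Qed.

Lemma cross_bigr b A B : (forall u, u \in part B (~~ b) -> ~~ small u) ->
  cross (part A b) (part B (~~ b)) <= #|part B (~~ b)|.
Proof. by move=> bigB; rewrite crossC; have := cross_big A bigB; rewrite negbK. Qed.

(** Each part has at most one small vertex. The two small ones miss at most two arcs between them;
    every other missing arc is charged to a big vertex, at most one each. *)
Lemma cross_le b A B :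
  cross (part A b) (part B (~~ b)) <= #|part A b| + #|part B (~~ b)|.
Proof.
have [x /andP[xA sx]|nx] := pickP (fun x => (x \in part A b) && small x); last first.
  rewrite (leq_trans (cross_big _ _)) ?leq_addr // => u uA.
  by have := nx u; rewrite uA => /negbT.
have [y /andP[yB sy]|ny] := pickP (fun y => (y \in part B (~~ b)) && small y); last first.
  rewrite (leq_trans (cross_bigr _ _)) ?leq_addl // => u uB.
  by have := ny u; rewrite uB => /negbT.
have cx : c x = b by move: xA; rewrite inE => /andP[_ /eqP].
have cy : c y = ~~ b by move: yB; rewrite inE => /andP[_ /eqP].
rewrite /cross (big_setD1 x) //= (big_setD1 y) //=.
rewrite [X in _ <= X + _](cardsD1 x) [X in _ <= _ + X](cardsD1 y) xA yB.
have leA : \sum_(u in part A b :\ x) \sum_(w in part B (~~ b)) miss_arcs u w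
    <= #|part A b :\ x|.
  rewrite -[X in _ <= X]muln1 -sum_nat_const; apply: leq_sum => u.
  rewrite !inE => /and3P[ux _ /eqP cu]; apply: big_miss_sum => [|w].
    by apply: contraNN ux => su; apply/eqP/small_uniq; rewrite ?cu.
  by rewrite inE => /andP[_ /eqP->]; rewrite cu.
have leB : \sum_(w in part B (~~ b) :\ y) miss_arcs x w <= #|part B (~~ b) :\ y|.
  rewrite -[X in _ <= X]muln1 -sum_nat_const; apply: leq_sum => w.
  rewrite !inE => /and3P[wy _ /eqP cw]; have := @big_miss_sum w [set x].
  rewrite big_set1 /miss_arcs addnC; apply=> [|v /set1P->].
    by apply: contraNN wy => sw; apply/eqP/small_uniq; rewrite ?cw.
  by rewrite cx cw negbK.
have lexy : miss_arcs x y <= 2 by rewrite /miss_arcs; case: (e x y) (e y x) => [] [].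
rewrite -addnA; apply: leq_trans (leq_add lexy (leq_add leB leA)) _.
by rewrite addnACA [X in _ + X <= _]addnC.
Qed.

(** * Arcs missing between an [f]-stable set and its complement *)

Section StableSet.

Variable A : {set T}.
Hypothesis fA : forall v, (f v \in A) = (v \in A).
Variables (v1 v2 : T).
Hypothesis (v1A : v1 \in A) (v2A : v2 \notin A).

Let starA u v : u \in A -> v \notin A -> ~~ (e u (f v) && e v (f u)).
Proof.
move=> uA vA; apply: star; apply: contraNN vA; apply: porbit_closed => // w.
by rewrite fA.
Qed.

Let fAC v : (f v \in ~: A) = (v \in ~: A). Proof. by rewrite !inE fA. Qed.

Let part_reindex (B : {set T}) b (F : T -> nat) :
  (forall v, (f v \in B) = (v \in B)) ->
  \sum_(w in part B (~~ b)) F w = \sum_(u in part B b) F (f u).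
Proof.
move=> fB; rewrite (reindex_inj (@perm_inj _ f)); apply: eq_bigl => v.
by rewrite !inE fB cf (inj_eq negb_inj).
Qed.

Let card_part (B : {set T}) b : (forall v, (f v \in B) = (v \in B)) ->
  #|part B (~~ b)| = #|part B b|.
Proof. by move=> fB; rewrite -!sum1_card part_reindex. Qed.

(** For [u] inside and [v] outside [A] on side [b], one of [u -> f v] and [v -> f u] is missing;
    reindexing by [f] shows that different pairs give different arcs. *)
Let half_cross b : #|part A b| * #|part (~: A) b| <=
  \sum_(u in part A b) \sum_(w in part (~: A) (~~ b)) ~~ e u w +
  \sum_(u in part (~: A) b) \sum_(w in part A (~~ b)) ~~ e u w.
Proof.
rewrite [X in _ <= _ + X]exchange_big /= part_reindex // -big_split /=.
rewrite -sum_nat_const; apply: leq_sum => u; rewrite inE => /andP[uA _].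
rewrite part_reindex // -big_split /= -[X in X <= _]muln1 -sum_nat_const.
apply: leq_sum => v; rewrite !inE => /andP[vA _].
by have := starA uA vA; case: (e u (f v)) (e v (f u)) => [] [].
Qed.

(** The bounds [half_cross] for [b] and [~~ b] are added, and the missing arcs regrouped by their
    ends. *)
Lemma cross_ge b : 2 * (#|part A b| * #|part (~: A) b|) <=
  cross (part A b) (part (~: A) (~~ b)) + cross (part (~: A) b) (part A (~~ b)).
Proof.
have H1 := half_cross b; have := half_cross (~~ b).
rewrite !card_part // negbK => H2.
rewrite mul2n -addnn; apply: leq_trans (leq_add H1 H2) _.
rewrite [X in _ + X <= _]addnC addnACA /cross.
rewrite leq_add // /miss_arcs; under [X in _ <= X]eq_bigr => u _ do rewrite big_split.
  by rewrite big_split /= leq_add // exchange_big.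
by rewrite big_split /= leq_add // exchange_big.
Qed.

Let part_gt0 b : 0 < #|part A b|.
Proof.
apply/card_gt0P; have [cv|cv] := eqVneq (c v1) b.
  by exists v1; rewrite inE v1A cv eqxx.
by exists (f v1); rewrite inE fA v1A cf; case: (c v1) b cv => [] [].
Qed.

Let part_setC_gt0 b : 0 < #|part (~: A) b|.
Proof.
apply/card_gt0P; have [cv|cv] := eqVneq (c v2) b.
  by exists v2; rewrite !inE v2A cv eqxx.
by exists (f v2); rewrite !inE fA v2A cf; case: (c v2) b cv => [] [].
Qed.

Let card_parts b : #|part A b| + #|part (~: A) b| = a.
Proof.
rewrite -(card_side b) -[RHS](cardsID A).
by congr (_ + _); apply: eq_card => v; rewrite !inE // andbC.
Qed.

(** One of the two counts in [cross_ge] involves big vertices only, hence is at most the size of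
    either part; the other is at most [a] by [cross_le]. *)
Lemma cut_not_mixed b : (forall u, u \in part (~: A) b -> ~~ small u) ->
  (forall u, u \in part A (~~ b) -> ~~ small u) -> False.
Proof.
move=> big1 big2.
apply: (no_mixed_cut (part_gt0 b) (part_setC_gt0 b) _ (cross_ge b)).
- by rewrite card_parts.
- by apply: leq_trans (cross_le _ _ _) _; rewrite card_part.
- by apply: leq_trans (cross_bigr _ big2) _; rewrite card_part.
- exact: cross_big.
Qed.

(** With k and l the sizes of side [b] inside and outside [A], both counts in [cross_ge] are at most
    l, so k = 1 and l >= 3. A big vertex in [A] would lower one count to 1, giving 2l <= l + 1; so
    both vertices of [A] are small. *)
Lemma cut_two_cycle b : (forall u, u \in part (~: A) b -> ~~ small u) ->
  (forall u, u \in part (~: A) (~~ b) -> ~~ small u) ->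
  exists x, [/\ small x, small (f x) & f (f x) = x].
Proof.
move=> big1 big2; have ge := cross_ge b.
have k_gt0 := part_gt0 b; have l_gt0 := part_setC_gt0 b; have kl := card_parts b.
have M1 := cross_bigr A big2; have M2 := cross_big A big1.
rewrite [#|part (~: A) (~~ b)|]card_part // in M1.
have k1 : #|part A b| = 1.
  apply/eqP; rewrite eqn_leq k_gt0 andbT -(leq_pmul2r l_gt0) mul1n.
  by rewrite -(@leq_pmul2l 2) // (leq_trans ge) // mul2n -addnn leq_add.
have l3 : 3 <= #|part (~: A) b| by have := a_ge4; rewrite -kl k1 add1n.
rewrite k1 mul1n mul2n -addnn in ge.
have [x /andP[xA sx]|nx] := pickP (fun x => (x \in part A b) && small x); last first.
  have bigx u : u \in part A b -> ~~ small u by move=> uA; have := nx u; rewrite uA => /negbT.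
  have := leq_trans ge (leq_add (cross_big (~: A) bigx) M2).
  by rewrite leq_add2r k1 => /(leq_trans l3).
have [y /andP[yA sy]|ny] := pickP (fun y => (y \in part A (~~ b)) && small y); last first.
  have bigy u : u \in part A (~~ b) -> ~~ small u.
    by move=> uA; have := ny u; rewrite uA => /negbT.
  have := leq_trans ge (leq_add M1 (cross_bigr (~: A) bigy)).
  by rewrite leq_add2l card_part // k1 => /(leq_trans l3).
have uniqA b' u v : u \in part A b' -> v \in part A b' -> u = v.
  move=> uA vA; have le1 : #|part A b'| <= 1; last exact: (card_le1_eqP le1).
  have [->|nb] := eqVneq b' b; first by rewrite k1.
  have -> : b' = ~~ b by case: (b') (b) nb => [] [].
  by rewrite card_part // k1.
exists x; move: xA yA; rewrite !inE => /andP[xA cx] /andP[yA cy].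
have fx : f x = y by apply: (uniqA (~~ b)); rewrite !inE ?fA ?xA ?yA ?cf ?(eqP cx) ?eqxx.
split; rewrite ?fx // -fx; apply: (uniqA b); rewrite !inE ?fA ?xA ?cf ?(eqP cx) ?negbK ?eqxx //.
Qed.

End StableSet.

(** On each side the orbit of [u0] or its complement has only big vertices. If the same set serves
    for both sides, [cut_two_cycle] applies to the other set; otherwise [cut_not_mixed] does. *)
Lemma small_two_cycle : exists x, [/\ small x, small (f x) & f (f x) = x].
Proof.
pose A := porbit f u0; have u0A : u0 \in A := porbit_id f u0.
have fA v : (f v \in A) = (v \in A) by exact: mem_porbit_perm.
have fAC v : (f v \in ~: A) = (v \in ~: A) by rewrite !inE fA.
have [v0A u0A'] : v0 \in ~: A /\ u0 \notin ~: A by rewrite !inE u0A.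
have AK : ~: ~: A = A := setCK A.
have big_or_big b : (forall u, u \in part A b -> ~~ small u) \/
                    (forall u, u \in part (~: A) b -> ~~ small u).
  have [x /andP[xA sx]|nx] := pickP (fun x => (x \in part A b) && small x); last first.
    by left=> u uA; have := nx u; rewrite uA => /negbT.
  right=> u; move: xA; rewrite !inE => /andP[xA /eqP cx] /andP[uA /eqP cu].
  by apply: contraNN uA => su; rewrite (small_uniq su sx) ?cu.
have [bt|bt] := big_or_big true; have [bf|bf] := big_or_big false.
- by apply: (cut_two_cycle fAC v0A u0A' (b := true)); rewrite ?AK.
- by case: (cut_not_mixed fAC v0A u0A' (b := true)); rewrite ?AK.
- by case: (cut_not_mixed fA u0A two_orbits (b := true)).
- exact: (cut_two_cycle fA u0A two_orbits (b := true)).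
Qed.

(* [B] collects the [v] with [x -> f v].  The exchange property and the bigness
   of all other vertices make [B] stable under [f^-2], and strong connectivity
   makes both [B] and its complement nonempty; since the vertices of the other
   side already miss an arc at [x] or [y], the exchange is then possible. *)
Lemma no_small_two_cycle x y :
  small x -> small y -> f x = y -> f y = x -> False.
Proof.
move=> sx sy fx fy; set b := c x.
have cy : c y = ~~ b by rewrite -fx cf.
have xy : x != y by apply/eqP=> xy; have := cf x; rewrite fx -xy; case: (c x).
have bigb v : c v = b -> v != x -> ~~ small v.
  by move=> cv; apply: contraNN => sv; apply/eqP/small_uniq.
have bign v : c v = ~~ b -> v != y -> ~~ small v.
  by move=> cv; apply: contraNN => sv; apply/eqP/small_uniq; rewrite ?cy.
have cfV v : c ((f^-1)%g v) = ~~ c v by rewrite -[v in RHS](permKV f) cf negbK.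
have orb u v : u \in [set x; y] -> v != x -> v != y -> v \notin porbit f u.
  move=> uxy vx vy; apply/negP=> /(porbit_closed uxy) vxy.
  suff: v \in [set x; y] by rewrite !inE (negPf vx) (negPf vy).
  by apply: vxy => w /set2P[]->; rewrite !inE ?fx ?fy eqxx ?orbT.
have xxy : x \in [set x; y] by rewrite !inE eqxx.
have yxy : y \in [set x; y] by rewrite !inE eqxx orbT.
have neqb u v : c u = b -> c v = ~~ b -> u != v.
  by move=> cu cv; apply/eqP=> uv; move: cu; rewrite uv cv; case: (b).
pose B := [set v | [&& c v == b, v != x & e x (f v)]].
(* With [z] the preimage of [v], the arc [y -> f z] forbids [z -> f y = x]; as [z] is big, [x -> z],
   which puts the preimage of [z] into [B]. *)
have stepY v : c v = b -> v != x -> e y v ->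
    ~~ e ((f^-1)%g v) x /\ (f^-1)%g ((f^-1)%g v) \in B.
  move=> cv vx eyv; set z := (f^-1)%g v; have fz : f z = v by rewrite permKV.
  have cz : c z = ~~ b by rewrite cfV cv.
  have zy : z != y by apply: contraNneq vx => zy; rewrite -fz zy fy.
  have zx : z != x by rewrite eq_sym neqb.
  have nzx : ~~ e z x by have := star (orb y z yxy zx zy); rewrite fz eyv fy.
  split=> //; rewrite inE permKV cfV cz negbK eqxx /=.
  apply/andP; split; first by apply: contraNneq zy => zx'; rewrite -fx -zx' permKV.
  by have := big_or (bign _ cz zy) (w := x); rewrite cz negbK (negPf nzx) => /(_ erefl).
have stepB v : v \in B ->
    [/\ ~~ e v y, ~~ e ((f^-1)%g v) x & (f^-1)%g ((f^-1)%g v) \in B].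
  rewrite inE => /and3P[/eqP cv vx exv].
  have vy : v != y by rewrite neqb.
  have nvy : ~~ e v y by have := star (orb x v xxy vx vy); rewrite exv fx.
  have eyv : e y v.
    by have := big_or (bigb _ cv vx) (w := y); rewrite cv (negPf nvy) => /(_ cy).
  by have [] := stepY v cv vx eyv.
have [t ct tx] : exists2 t, c t = b & t != x.
  have /card_gt1P[t1 [t2 []]] : 1 < #|[set v | c v == b]|.
    by rewrite card_side (leq_trans _ a_ge4).
  rewrite !inE => /eqP c1 /eqP c2 t12.
  by have [t1x|] := eqVneq t1 x; [exists t2; rewrite // -t1x eq_sym | exists t1].
have ty : t != y by rewrite neqb.
(* If [B] were empty, no arc would leave [{x, y}]. *)
have [v vB] : exists v, v \in B.
  apply/existsP; apply: contraT; rewrite negb_exists => /forallP noB.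
  suff: t \in [set x; y] by rewrite !inE (negPf tx) (negPf ty).
  apply: (closed_set_full strong xxy) => _ w /set2P[]-> ew.
    have cw := bip ew; rewrite !inE; have [//|wx /=] := eqVneq w x.
    apply: contraT => wy; have /negP[] := noB ((f^-1)%g w).
    rewrite inE permKV ew cfV cw negbK eqxx /= andbT.
    by apply: contraNneq wy => wx'; rewrite -fx -wx' permKV.
  have cw : c w = b by have := bip ew; rewrite cy negbK.
  rewrite !inE; have [//|wx] := eqVneq w x.
  have [_ wB] := stepY w cw wx ew; by have := noB ((f^-1)%g ((f^-1)%g w)); rewrite wB.
(* If [B] were all of side [b] except [x], no arc would enter [{x, y}]. *)
have [s [cs sx' sB]] : exists s, [/\ c s = b, s != x & s \notin B].
  have [s /and3P[/eqP cs ? ?]|allB] := pickP (fun s => [&& c s == b, s != x & s \notin B]).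
    by exists s.
  have {}allB s : c s = b -> s != x -> s \in B.
    by move=> cs sx'; have := allB s; rewrite cs eqxx sx' => /negbFE.
  suff: x \in ~: [set x; y] by rewrite !inE eqxx.
  apply: (closed_set_full strong (x := t)); first by rewrite !inE negb_or tx.
  move=> u w; rewrite !inE !negb_or => /andP[ux uy] euw; apply/andP; split; apply/eqP=> wE.
    have cu : c u = ~~ b by have := bip euw; rewrite wE => cu; rewrite /b cu negbK.
    have fuB : f u \in B.
      by apply: allB; rewrite ?cf ?cu ?negbK // -fy (inj_eq perm_inj).
    by have [_ + _] := stepB _ fuB; rewrite permK -wE euw.
  have cu : c u = b by have := bip euw; rewrite wE cy => /negb_inj.
  by have [+ _ _] := stepB _ (allB u cu ux); rewrite -wE euw.
have [nvy nzx v'B] := stepB v vB.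
(* The exchange uses [v'] instead of [v], since its image [z] is known to miss the arc to [x]. *)
set z := (f^-1)%g v in nzx v'B; set v' := (f^-1)%g z in v'B.
have [nv'y _ _] := stepB v' v'B.
have fv' : f v' = z by rewrite permKV.
have [cv' v'x _] : [/\ c v' = b, v' != x & e x z].
  by move: v'B; rewrite inE fv' => /and3P[/eqP].
have cz : c z = ~~ b by rewrite -fv' cf cv'.
have zy : z != y by rewrite -fv' -fx (inj_eq perm_inj).
have sorb : s \notin porbit f v'.
  rewrite -porbitV; apply/negP=> sv'.
  pose Z := [set w | (w \in B) || ((f^-1)%g w \in B)].
  have: s \in Z.
    apply: (porbit_closed _ _ sv') => [|w]; first by rewrite inE v'B.
    rewrite inE => /orP[/stepB[_ _ wB]|wB]; by rewrite inE wB ?orbT.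
  by rewrite inE (negPf sB) inE cfV cs; case: (b).
(* The big [v'] misses its arc to [y], so [v' -> f s]; the big [z = f v'] misses its arc to [x], so
   [s -> f v']. *)
have := star sorb; case/negP; apply/andP; split.
  have fsy : y != f s by rewrite -fx (inj_eq perm_inj) eq_sym.
  by case: (big_full (bigb _ cv' v'x) _ _ fsy); rewrite ?cf ?cv' ?cs ?cy ?(negPf nv'y).
rewrite fv'; have xs : x != s by rewrite eq_sym.
by case: (big_full (bign _ cz zy) _ _ xs); rewrite ?cz ?negbK ?cs ?(negPf nzx) ?andbF.
Qed.

End OneSmall.

(** * Conclusion: a minimal factor with two cycles forces D(8) *)

Lemma two_orbits_D8 : digraph_iso e D8.
Proof.
have [/not_all_small//|few] := all_small_or_few.
have [b two|one] := pickP (fun b => 1 < #|small_side b|).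
  have /card_gt0P[z0 z0b] : 0 < #|big_side (~~ b)|.
    by have := card_big_side (~~ b); have := few (~~ b); lia.
  exact: (two_small_D8 few two z0b).
have {}one b : #|small_side b| <= 1 by rewrite leqNgt one.
have [x [sx sfx ffx]] := small_two_cycle one.
by case: (no_small_two_cycle one sx sfx erefl ffx).
Qed.

End MinimalFactor.

Lemma hamiltonian_or_D8 : hamiltonian e \/ digraph_iso e D8.
Proof.
have [f [ef star]] := minimal_cycle_factor.
have /card_gt0P[u0 _] : 0 < #|[set v | c v == true]|.
  by rewrite card_side (leq_trans _ a_ge4).
have [v0 v0P|one] := pickP (fun v => v \notin porbit f u0).
  by right; apply: two_orbits_D8 ef star v0P.
by left; apply: (hamiltonian_perm ef) => v; apply/negbFE/one.
Qed.

End DegreeCondition.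

Theorem theorem1p9 (T : finType) (e : rel T) (a : nat)
    (loopless : irreflexive e)
    (strong : strongly_connected e)
    (bal : balanced_bipartite e)
    (order : #|T| = 2 * a) (order_ge8 : 8 <= 2 * a)
    (deg_cond : forall x y : T, x <> y -> common_out_neighbour e x y ->
       2 * a - 1 <= maxn (deg e x) (deg e y)) :
  ~ digraph_iso e D8 -> hamiltonian e.
Proof.
have [X [Y [[XYT XY0 arcs] cardXY]]] := bal.
have YE : Y = ~: X.
  apply/setP=> v; have := in_setT v; rewrite -XYT !inE => XYv.
  have := in_set0 v; rewrite -XY0 inE.
  by case: (v \in X) (v \in Y) XYv => [] [].
have cardX : #|X| = a by have := cardsC X; rewrite -YE -cardXY order; lia.
have bip u v : e u v -> (v \in X) = ~~ (u \in X).
  by case/arcs; rewrite YE !inE => -[]; [move=> -> /negbTE | move=> /negbTE->].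
have card_side b : #|[set v | (v \in X) == b]| = a.
  case: b; [rewrite -[RHS]cardX | rewrite -[RHS]cardX cardXY YE].
    by apply: eq_card => v; rewrite !inE eqb_id.
  by apply: eq_card => v; rewrite !inE eqbF_neg.
have a_ge4 : 4 <= a by lia.
by have [] := hamiltonian_or_D8 bip card_side a_ge4 strong deg_cond.
Qed.
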